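(* Let $2\leq k<r$ be integers and let $d\geq 1$ be an integer with $d<\frac{kr}{r-k}-1$. Then $T(d,r,k)=(d+1)(r-1)+1$.
   Context: For integers $d\geq 1$ and $2\leq k\leq r$, $T(d,r,k)$ denotes the smallest positive integer $n$ with the following property: for any list $a_1,\dots,a_n$ of (not necessarily distinct) points in $\mathbb{R}^d$, there is a partition of the index set $\{1,\dots,n\}$ into $r$ disjoint parts $N_1,\dots,N_r$ such that every $k$ of the $r$ convex hulls $\mathrm{conv}\{a_i : i\in N_j\}$ ($j=1,\dots,r$) have a point in common. *)

(* Defs.v *)
(* MathComp / MathComp-Analysis *)
From mathcomp Require Import all_boot all_order all_algebra.
From mathcomp Require Import boolp classical_sets reals convex.

Set Implicit Arguments.
Unset Strict Implicit.
Unset Printing Implicit Defensive.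

Import Order.TTheory GRing.Theory Num.Theory.
Local Open Scope ring_scope.

(* Parts are indexed and not required to be nonempty: in [tverberg_property]
   with 2 <= k <= r, an empty part has an empty convex hull, so the
   intersection condition rules it out. *)
Definition partition_into_parts (n r : nat) (N : 'I_r -> {set 'I_n}) : Prop :=
  (forall j l : 'I_r, j != l -> [disjoint N j & N l]) /\
  (forall i : 'I_n, exists j : 'I_r, i \in N j).

Local Open Scope classical_set_scope.

Definition convex_hull (R : realType) (d : nat) (A : set 'rV[R]_d) :
    set 'rV[R]_d :=
  smallest (@convex_set R 'rV[R]_d) A.

Definition tverberg_property (R : realType) (d r k n : nat) : Prop :=
  forall a : 'I_n -> 'rV[R]_d,
    exists N : 'I_r -> {set 'I_n},
      partition_into_parts N /\
      forall J : {set 'I_r}, #|J| = k ->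
        exists x : 'rV[R]_d, forall j : 'I_r, j \in J ->
          convex_hull [set a i | i in [set` N j]] x.

(* [is_tverberg_number R d r k n] reads T(d, r, k) = n; stating it as a relation
   avoids choosing a default value for a minimum. *)
Definition is_tverberg_number (R : realType) (d r k n : nat) : Prop :=
  [/\ (0 < n)%N, tverberg_property R d r k n &
      forall m : nat, (0 < m)%N -> tverberg_property R d r k m -> (n <= m)%N].

(* Main.v *)
(* The upper bound is Tverberg's theorem, by Sarkaria's reduction to the colourful
   Caratheodory theorem.

   For the lower bound put D = d + 1, take D rays from the origin spanned by the
   vertices e_0, ..., e_d of a simplex with barycentre 0, and place at most r - 1
   points on each, at distances (D + 1)^0, (D + 1)^1, ...  Each ray is then missed
   by some of the r parts; let J be the set of parts missing at least one ray and
   q = |J|.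
   If the hulls of a set K of parts from J share a point, then its normalised
   coordinates y on the rays are the same for all these parts, so y vanishes on the
   rays missed by some part of K.  On a ray i with y_i > 0 let T_i be the smallest,
   over K, of the largest distance of a point of the part; then y_i <= T_i.  If the
   points of some part of K were all at distance >= (D + 1) T_i on each such ray, their
   weights would add up to at most D / (D + 1) < 1.  So every part of K fails this on
   some ray, and on ray i it can only fail for the part defining T_i and for the parts
   having at least two points on the ray:
     |K| <= sum over the rays i missed by no part of K of (1 + |K /\ E_i|),
   with E_i the set of parts having at least two points on ray i.  Here |E_i| is smaller than
   the number of parts missing i, so summing over all k-subsets K of J gives
   k C(q, k) <= D C(q - 1, k), i.e. k q <= D (q - k), contradicting D (r - k) < k r.
   If q <= k one takes K = J, for which the right-hand side is empty. *)

Require Import Defs.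
From mathcomp Require Import boolp classical_sets topology normedtype derive convex.
From mathcomp Require Import all_boot all_order all_algebra.
From mathcomp Require Import reals interval_inference.
From mathcomp Require Import zify ring lra.
Import GRing.Theory Num.Theory.
Import Order.TTheory.
Import numFieldNormedType.Exports.
Local Open Scope ring_scope.

Set Implicit Arguments.
Unset Strict Implicit.
Unset Printing Implicit Defensive.

(** * Convex hulls of finite families *)

Section Convex.
Variable R : realType.

Definition convex_weights (T : finType) (A : {set T}) (l : T -> R) :=
  [/\ forall i, 0 <= l i, forall i, i \notin A -> l i = 0 & \sum_i l i = 1].

(** The weights are divided by their total because in the induction the weights of a tail no longer
    sum to 1. *)
Lemma convex_set_sum (d : nat) (T : eqType) (C : set 'rV[R]_d) (l : T -> R)
    (a : T -> 'rV[R]_d) (s : seq T) :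
  convex_set C -> (forall i, 0 <= l i) ->
  (forall i, i \in s -> l i != 0 -> C (a i)) ->
  0 < \sum_(i <- s) l i ->
  C ((\sum_(i <- s) l i)^-1 *: \sum_(i <- s) l i *: a i).
Proof.
move=> convC l0; elim: s => [|i s IHs] aC; first by rewrite big_nil ltxx.
rewrite !big_cons.
have aCs j : j \in s -> l j != 0 -> C (a j).
  by move=> js; apply: aC; rewrite inE js orbT.
have [li0|li0] := eqVneq (l i) 0.
  by rewrite li0 scale0r !add0r; exact: IHs.
have aCi : C (a i) by apply: aC => //; rewrite inE eqxx.
have li_gt0 : 0 < l i by rewrite lt_def li0 l0.
move=> _.
have [s0|s0] := eqVneq (\sum_(j <- s) l j) 0.
  have /allP ls0 : all (fun j => l j == 0) s.
    by move/eqP: s0; rewrite psumr_eq0.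
  have -> : \sum_(j <- s) l j *: a j = 0.
    by rewrite big_seq big1// => j js; rewrite (eqP (ls0 _ js)) scale0r.
  by rewrite s0 !addr0 scalerA mulVf// scale1r.
have s_gt0 : 0 < \sum_(j <- s) l j by rewrite lt_def s0 sumr_ge0.
have Cs := IHs aCs s_gt0.
set S := \sum_(j <- s) l j in s_gt0 s0 Cs *.
have k0 : 0 <= l i / (l i + S) by rewrite divr_ge0// addr_ge0// ltW.
have lS : 0 < l i + S by rewrite addr_gt0.
have k1 : l i / (l i + S) <= 1 by rewrite ler_pdivrMr// mul1r lerDl ltW.
have := convC (a i) _ (Itv01 k0 k1) (mem_set aCi) (mem_set Cs).
move=> /set_mem h.
set V := \sum_(j <- s) _ in h *.
suff -> : (l i + S)^-1 *: (l i *: a i + V) =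
    (l i / (l i + S)) *: a i + (1 - l i / (l i + S)) *: (S^-1 *: V) by exact: h.
rewrite scalerDr !scalerA mulrC; congr (_ + _ *: _).
by field; rewrite s0 gt_eqF.
Qed.

(** The convex combinations form a convex set containing the points, and by [convex_set_sum] every
    such set contains them. *)
Lemma convex_hull_finP (d : nat) (T : finType) (A : {set T}) (a : T -> 'rV[R]_d)
    (x : 'rV[R]_d) :
  convex_hull [set a i | i in [set` A]]%classic x <->
  exists2 l : T -> R, convex_weights A l & x = \sum_i l i *: a i.
Proof.
split; last first.
  move=> [l [l0 lA l1]] -> C [convC aC].
  have := @convex_set_sum d T C l a (index_enum T) convC l0.
  rewrite l1 invr1 scale1r; apply => // i _ li0.
  by apply: aC; exists i => //=; apply: contraNT li0 => /lA/eqP.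
move=> hx; apply: (hx [set y | exists2 l : T -> R, convex_weights A l &
  y = \sum_i l i *: a i]%classic); split; last first.
  move=> _ [i /= iA <-]; exists (fun j => (j == i)%:R).
    split => [j|j|]; first by rewrite ler0n.
      by move=> jA; case: eqP => // ji; rewrite ji iA in jA.
    by rewrite (bigD1 i)//= eqxx big1 ?addr0// => j /negPf ->.
  rewrite (bigD1 i)//= eqxx scale1r big1 ?addr0// => j /negPf ->.
  by rewrite scale0r.
move=> y z t /set_mem[l [l0 lA l1] ->] /set_mem[m [m0 mA m1] ->]; apply/mem_set.
exists (fun i => t%:num * l i + (1 - t%:num) * m i).
  split=> [i|i iA|].
  - by rewrite addr_ge0// mulr_ge0// subr_ge0.
  - by rewrite lA// mA// !mulr0 addr0.
  - by rewrite big_split/= -!mulr_sumr l1 m1 !mulr1 addrC subrK.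
under [RHS]eq_bigr do rewrite scalerDl -!scalerA.
by rewrite big_split/= -!scaler_sumr.
Qed.

End Convex.

(** * Tverberg's theorem *)

Section NearestPoint.
Variable R : realType.

Lemma sum_continuous (T : topologicalType) (I : finType) (F : I -> T -> R) :
  (forall i, continuous (F i)) -> continuous (fun v => \sum_i F i v).
Proof.
move=> cF; exact: (@continuous_big R^o I +%R 0 xpredT (@add_continuous R^o) T
  (index_enum I) F (fun i _ => cF i)).
Qed.

Definition dotr (N : nat) (u v : 'rV[R]_N) : R := \sum_i u 0 i * v 0 i.

Lemma dotr_combl (N : nat) (T : finType) (l : T -> R) (p : T -> 'rV[R]_N) (v : 'rV[R]_N) :
  dotr (\sum_x l x *: p x) v = \sum_x l x * dotr (p x) v.
Proof.
rewrite /dotr; under eq_bigr do rewrite summxE mulr_suml.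
rewrite exchange_big/=; apply: eq_bigr => x _; rewrite mulr_sumr.
by apply: eq_bigr => i _; rewrite mxE mulrA.
Qed.

Lemma dotr_ge0 (N : nat) (u : 'rV[R]_N) : 0 <= dotr u u.
Proof. by apply: sumr_ge0 => i _; exact: sqr_ge0. Qed.

Lemma dotr_eq0 (N : nat) (u : 'rV[R]_N) : dotr u u = 0 -> u = 0.
Proof.
move=> u0; apply/rowP => i; rewrite mxE; apply/eqP; rewrite -sqrf_eq0; apply/eqP.
exact: (psumr_eq0P (fun i _ => sqr_ge0 (u 0 i)) u0).
Qed.

Lemma dotr_shift (N : nat) (z p : 'rV[R]_N) (t : R) :
  dotr ((1 - t) *: z + t *: p) ((1 - t) *: z + t *: p) =
  dotr z z - 2 * t * (dotr z z - dotr p z) + t ^+ 2 * dotr (p - z) (p - z).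
Proof.
rewrite /dotr -sumrB !mulr_sumr -sumrB -big_split/=; apply: eq_bigr => i _.
rewrite !mxE; ring.
Qed.

(* Otherwise a small step from [z] towards [p] would come closer to 0. *)
Lemma dotr_segment_min (N : nat) (z p : 'rV[R]_N) :
  (forall t, 0 <= t <= 1 ->
     dotr z z <= dotr ((1 - t) *: z + t *: p) ((1 - t) *: z + t *: p)) ->
  dotr z z <= dotr p z.
Proof.
move=> hmin; rewrite leNgt; apply/negP => lt.
set e := dotr z z - dotr p z; have e0 : 0 < e by rewrite subr_gt0.
set D := dotr (p - z) (p - z); have D0 : 0 <= D by exact: dotr_ge0.
have De : 0 < D + e by exact: ltr_wpDl.
have t0 : 0 < e / (D + e) by rewrite divr_gt0.
have t1 : e / (D + e) <= 1 by rewrite ler_pdivrMr// mul1r lerDr.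
have tE : e / (D + e) * (D + e) = e by rewrite divfK// gt_eqF.
have := hmin (e / (D + e)); rewrite (ltW t0) t1 => /(_ isT).
rewrite dotr_shift -/e -/D; move: (e / (D + e)) t0 t1 tE => t t0 t1 tE.
nra.
Qed.

Lemma nearest_point (m N : nat) (p : 'I_m.+1 -> 'rV[R]_N) :
  exists2 l : 'I_m.+1 -> R, convex_weights [set: 'I_m.+1] l &
  forall l', convex_weights [set: 'I_m.+1] l' ->
  dotr (\sum_i l i *: p i) (\sum_i l i *: p i) <=
  dotr (\sum_i l' i *: p i) (\sum_i l' i *: p i).
Proof.
(* [A] is the standard simplex, compact as a closed part of the unit cube, and [f] is continuous on
   it. *)
pose A := ([set v : 'rV[R]_m.+1 | forall i, `[0%R, 1%R]%classic (v ord0 i)] `&`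
  (fun v : 'rV[R]_m.+1 => \sum_i v ord0 i) @^-1` [set 1])%classic.
pose f (v : 'rV[R]_m.+1) := dotr (\sum_i v ord0 i *: p i) (\sum_i v ord0 i *: p i).
have AE l : convex_weights [set: 'I_m.+1] l -> A (\row_i l i).
  move=> [l0 _ l1]; split => /= [i|]; last by under eq_bigr do rewrite mxE.
  rewrite in_itv/= mxE l0 -l1 (bigD1 i)//= lerDl sumr_ge0//.
have [|||v vA vmin] := @EVT_min_rV R m.+1 f A.
- exists (\row_i (i == ord0)%:R); apply: AE; split=> [i|i|].
  + by rewrite ler0n.
  + by rewrite finset.inE.
  + by rewrite (bigD1 ord0)//= big1 ?addr0// => i /negPf ->.
- apply: (compact_closedI (rV_compact (fun=> @segment_compact _ _ _))).
  have /continuous_closedP : continuous (fun v : 'rV[R]_m.+1 => \sum_i v ord0 i).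
    apply: sum_continuous => i; exact: coord_continuous.
  by apply; exact: closed_eq.
- apply: continuous_subspaceT; apply: sum_continuous => i.
  have c : continuous (fun v : 'rV[R]_m.+1 => (\sum_i v ord0 i *: p i) 0 i).
    rewrite (_ : (fun _ => _) = fun v : 'rV[R]_m.+1 => \sum_j v ord0 j * p j 0 i).
      apply: sum_continuous => j v.
      apply: cvgMr_tmp; [exact: nbhs_filter|exact: coord_continuous].
    by apply/funext => w; rewrite summxE; apply: eq_bigr => j _; rewrite mxE.
  by move=> v; apply: cvgM; [exact: nbhs_filter|exact: c|exact: c].
have [v01 v1] := set_mem vA.
exists (fun i => v ord0 i).
  split => // [i|i]; first by have := v01 i; rewrite /= in_itv/= => /andP[].
  by rewrite inE.
move=> l' /AE/mem_set/vmin; rewrite /f.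
by under [X in _ <= dotr X _]eq_bigr do rewrite mxE;
  under [X in _ <= dotr _ X]eq_bigr do rewrite mxE.
Qed.

End NearestPoint.

(** * The colourful Caratheodory theorem *)

Section ColourfulCaratheodory.
Variable R : realType.

Lemma sum_delta_scale (T : finType) (V : lmodType R) (p : T -> V) (x : T) :
  \sum_y (y == x)%:R *: p y = p x.
Proof.
by rewrite (bigD1 x)//= eqxx scale1r big1 ?addr0// => y /negPf ->; rewrite scale0r.
Qed.

Lemma convex_weights_segment (T : finType) (A : {set T}) (l : T -> R) (x : T) (t : R) :
  x \in A -> 0 <= t <= 1 -> convex_weights A l ->
  convex_weights A (fun y => (1 - t) * l y + t * (y == x)%:R).
Proof.
move=> xA /andP[t0 t1] [l0 lA l1]; split=> [y|y yA|].
- by rewrite addr_ge0// mulr_ge0// ?subr_ge0.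
- by rewrite lA//; case: eqP => [yx|_]; [rewrite yx xA in yA|rewrite !mulr0 addr0].
- rewrite big_split/= -!mulr_sumr l1 (bigD1 x)//= eqxx big1 => [|y /negPf ->//].
  by rewrite addr0 !mulr1 subrK.
Qed.

Lemma nearest_point_dotr (m N : nat) (p : 'I_m.+1 -> 'rV[R]_N) (l : 'I_m.+1 -> R)
    (z : 'rV[R]_N) (x : 'I_m.+1) :
  convex_weights [set: 'I_m.+1] l -> z = \sum_i l i *: p i ->
  (forall l', convex_weights [set: 'I_m.+1] l' ->
    dotr z z <= dotr (\sum_i l' i *: p i) (\sum_i l' i *: p i)) ->
  dotr z z <= dotr (p x) z.
Proof.
move=> wl zE zmin; apply: dotr_segment_min => t t01.
have := zmin _ (convex_weights_segment (in_setT x) t01 wl).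
under eq_bigr do rewrite scalerDl -!scalerA.
by rewrite big_split/= -!scaler_sumr sum_delta_scale -zE.
Qed.

Lemma exists_linear_relation (N : nat) (p : 'I_N.+1 -> 'rV[R]_N) :
  exists2 w : 'I_N.+1 -> R, (exists i, w i != 0) & \sum_i w i *: p i = 0.
Proof.
pose M := \matrix_i p i.
have : kermx M != 0.
  rewrite kermx_eq0 -row_leq_rank -ltnNge ltnS; exact: rank_leq_col.
case/rowV0Pn => v /sub_kermxP vM v0.
exists (fun i => v 0 i).
  by apply/existsP; apply: contraNT v0 => /existsPn h; apply/eqP/rowP => i;
     rewrite mxE; apply/eqP; have := h i; rewrite negbK.
rewrite -[RHS]vM mulmx_sum_row; apply: eq_bigr => i _.
by rewrite rowK.
Qed.

(* If all weights are positive then all [p i] lie on the hyperplane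
   [dotr v z = dotr z z], which misses 0, so a linear relation between
   them is an affine one, along which a weight can be moved to 0. *)
Lemma exists_zero_weight (N : nat) (p : 'I_N.+1 -> 'rV[R]_N) (l : 'I_N.+1 -> R)
    (z : 'rV[R]_N) :
  convex_weights [set: 'I_N.+1] l -> z = \sum_i l i *: p i -> z != 0 ->
  (forall i, dotr z z <= dotr (p i) z) ->
  exists l' x, [/\ convex_weights [set: 'I_N.+1] l', l' x = 0 &
    z = \sum_i l' i *: p i].
Proof.
move=> wl zE z0 zmin; have [l0 _ l1] := wl.
have [[x lx]|pos] := pselect (exists x, l x = 0); first by exists l, x.
have {}pos i : 0 < l i.
  by rewrite lt_def l0 andbT; apply/eqP => li; apply: pos; exists i.
have zz : dotr z z != 0 by apply: contra_neq z0; exact: dotr_eq0.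
have onplane i : dotr (p i) z = dotr z z.
  have F0 j : true -> 0 <= l j * (dotr (p j) z - dotr z z).
    by move=> _; rewrite mulr_ge0// subr_ge0.
  have s0 : \sum_j l j * (dotr (p j) z - dotr z z) = 0.
    under eq_bigr do rewrite mulrBr.
    by rewrite sumrB -dotr_combl -zE -mulr_suml l1 mul1r subrr.
  have /eqP := @psumr_eq0P _ _ _ _ F0 s0 i isT.
  by rewrite mulf_eq0 gt_eqF//= subr_eq0 => /eqP.
have [w w0 wp] := exists_linear_relation p.
have sw : \sum_i w i = 0.
  have : dotr (\sum_i w i *: p i) z = (\sum_i w i) * dotr z z.
    by rewrite dotr_combl mulr_suml; apply: eq_bigr => i _; rewrite onplane.
  rewrite wp /dotr big1 => [/esym/eqP|i _]; last by rewrite mxE mul0r.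
  by rewrite mulf_eq0 (negPf zz) orbF => /eqP.
have [i0 wi0] : exists i, 0 < w i.
  apply: contrapT => npos; have {}npos i : true -> 0 <= - w i.
    by move=> _; rewrite oppr_ge0 leNgt; apply/negP => wi; apply: npos; exists i.
  have [i] := w0; have := psumr_eq0P npos; rewrite sumrN sw oppr0 => /(_ erefl i isT).
  by move/eqP; rewrite oppr_eq0 => ->.
(* Moving [l] along [- w], the weight with the least ratio [l i / w i] is the first to reach 0. *)
pose x := [arg min_(i < i0 | 0 < w i) (l i / w i)]%O.
have [wx xmin] : 0 < w x /\ forall i, 0 < w i -> l x / w x <= l i / w i.
  by rewrite /x; case: arg_minP => // i wi h; split.
exists (fun i => l i - l x / w x * w i), x; split.
- split=> [i|i|]; last first.
  + by rewrite sumrB -mulr_sumr sw mulr0 subr0.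
  + by rewrite finset.inE.
  rewrite subr_ge0; have [wi|wi] := ltP 0 (w i).
    by rewrite -ler_pdivlMr// xmin.
  by apply: le_trans (l0 i); rewrite mulr_ge0_le0// divr_ge0// ltW.
- by rewrite divfK ?subrr// gt_eqF.
- under eq_bigr do rewrite scalerBl -scalerA.
  by rewrite sumrB -scaler_sumr wp scaler0 subr0.
Qed.

(** Barany's argument: take the rainbow choice whose hull comes nearest to 0. If its nearest point
    [z] is not 0, some colour has weight 0 in [z] and can be exchanged for a point on the other side
    of the hyperplane through 0 orthogonal to [z]. *)
Theorem colourful_caratheodory (N : nat) (J : finType) (c : 'I_N.+1 -> J -> 'rV[R]_N) :
  (forall x, exists2 m : J -> R, convex_weights [set: J] m & \sum_j m j *: c x j = 0) ->
  exists f : 'I_N.+1 -> J, exists2 l : 'I_N.+1 -> R,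
    convex_weights [set: 'I_N.+1] l & \sum_x l x *: c x (f x) = 0.
Proof.
move=> c0.
have [j0] : exists j0 : J, True.
  have [m [_ _ m1] _] := c0 ord0; have [j _|J0] := pickP (@predT J); first by exists j.
  by move: m1; rewrite big_pred0// => /eqP; rewrite eq_sym oner_eq0.
move=> _.
pose z (l : 'I_N.+1 -> R) (f : 'I_N.+1 -> J) := \sum_x l x *: c x (f x).
have /choice[l lP] : forall f : {ffun 'I_N.+1 -> J}, exists l : 'I_N.+1 -> R,
    convex_weights [set: 'I_N.+1] l /\
    forall l', convex_weights [set: 'I_N.+1] l' ->
      dotr (z l f) (z l f) <= dotr (z l' f) (z l' f).
  by move=> f; have [l wl lmin] := nearest_point (fun x => c x (f x)); exists l.
pose f := [arg min_(f < [ffun=> j0] | true) dotr (z (l f) f) (z (l f) f)]%O.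
have fmin g : dotr (z (l f) f) (z (l f) f) <= dotr (z (l g) g) (z (l g) g).
  by rewrite /f; case: arg_minP => // h _; apply.
have [wl lmin] := lP f.
have [z0|z0] := eqVneq (z (l f) f) 0; first by exists f, (l f).
exfalso.
have near x : dotr (z (l f) f) (z (l f) f) <= dotr (c x (f x)) (z (l f) f).
  exact: (@nearest_point_dotr _ _ (fun x => c x (f x)) (l f) _ x wl erefl lmin).
have [l' [x [wl' l'x zE]]] := exists_zero_weight wl erefl z0 near.
have [m [m0 _ m1] mc] := c0 x.
(* Averaged with the weights [m], the products [dotr (c x j) z] give 0, so they are not all
   positive. *)
have [j cj] : exists j, dotr (c x j) (z (l f) f) <= 0.
  apply: contrapT => none.
  have {}none j : 0 < dotr (c x j) (z (l f) f).
    by rewrite ltNge; apply/negP => h; apply: none; exists j.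
  have F0 j : true -> 0 <= m j * dotr (c x j) (z (l f) f).
    by move=> _; rewrite mulr_ge0// ltW.
  have s0 : \sum_j m j * dotr (c x j) (z (l f) f) = 0.
    by rewrite -dotr_combl mc /dotr big1// => i _; rewrite mxE mul0r.
  have : \sum_j m j = 0.
    apply: big1 => j _; have /eqP := @psumr_eq0P _ _ _ _ F0 s0 j isT.
    by rewrite mulf_eq0 orbC gt_eqF//= => /eqP.
  by rewrite m1 => /eqP; rewrite oner_eq0.
(* Since colour [x] has weight 0, [z] stays in the hull of the new choice; by minimality of [f] it
   is nearest to 0 there too, which forces [dotr z z <= dotr (c x j) z <= 0]. *)
pose g : {ffun 'I_N.+1 -> J} := [ffun y => if y == x then j else f y].
have zg : z (l f) f = z l' g.
  apply: etrans zE _; apply: eq_bigr => y _; rewrite ffunE; case: eqP => // ->.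
  by rewrite l'x !scale0r.
have gmin l1 : convex_weights [set: 'I_N.+1] l1 ->
    dotr (z (l f) f) (z (l f) f) <= dotr (z l1 g) (z l1 g).
  by move=> w1; apply: le_trans (fmin g) _; exact: (lP g).2.
have := @nearest_point_dotr _ _ (fun y => c y (g y)) l' _ x wl' zg gmin.
rewrite ffunE eqxx => /le_trans/(_ cj).
by rewrite le_eqVlt ltNge dotr_ge0 orbF => /eqP/dotr_eq0/eqP; exact/negP.
Qed.

End ColourfulCaratheodory.

(** * Simplex vertices and Sarkaria's reduction *)

Section Vertices.
Variables (R : realType) (s : nat).

(* [e_0, ..., e_(s-1), - (e_0 + ... + e_(s-1))]: up to a scalar, their only linear
   relation is that they sum to 0. *)
Definition simplex_vertex (j : 'I_s.+1) : 'rV[R]_s :=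
  \row_i ((j == lift ord_max i)%:R - (j == ord_max)%:R).

Lemma sum_simplex_vertexE (y : 'I_s.+1 -> R) (i : 'I_s) :
  (\sum_j y j *: simplex_vertex j) 0 i = y (lift ord_max i) - y ord_max.
Proof.
rewrite summxE; under eq_bigr do rewrite !mxE mulrBr.
rewrite sumrB; congr (_ - _).
  rewrite (bigD1 (lift ord_max i))//= eqxx mulr1 big1 ?addr0// => j /negPf ->.
  by rewrite mulr0.
rewrite (bigD1 ord_max)//= eqxx mulr1 big1 ?addr0// => j /negPf ->.
by rewrite mulr0.
Qed.

Lemma sum_simplex_vertex_inj (y z : 'I_s.+1 -> R) (j : 'I_s.+1) :
  \sum_j y j *: simplex_vertex j = \sum_j z j *: simplex_vertex j ->
  y j - z j = y ord_max - z ord_max.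
Proof.
move=> h; case: (unliftP ord_max j) => [i|] ->//.
move: (congr1 (fun v : 'rV[R]_s => v 0 i) h); rewrite /= !sum_simplex_vertexE.
lra.
Qed.

End Vertices.

(* Sarkaria's reduction: tensoring the lifted point [(a x, 1)] with the [s.+1]
   vertices of a simplex gives a colour class with barycentre 0, and a vanishing
   rainbow combination means that the weighted sums over the parts agree. *)
Theorem tverberg_property_upper (R : realType) (d s k : nat) :
  tverberg_property R d s.+1 k ((d + 1) * s).+1.
Proof.
move=> a.
pose b x : 'rV[R]_(d + 1) := row_mx (a x) (const_mx 1).
pose c x (j : 'I_s.+1) : 'rV[R]_((d + 1) * s) := mxvec ((b x)^T *m simplex_vertex R j).
have [x|f [l [l0 _ l1] l_eq0]] := @colourful_caratheodory _ _ _ c.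
  exists (fun=> s.+1%:R^-1).
    split=> [i|i|]; [by rewrite invr_ge0|by rewrite finset.inE|].
    by rewrite sumr_const card_ord -[_ *+ _]mulr_natr mulVf// pnatr_eq0.
  have v0 : \sum_j simplex_vertex R j = 0 :> 'rV[R]_s.
    apply/rowP => i; rewrite (eq_bigr (fun j => 1 *: simplex_vertex R j)) => [|j _].
      by rewrite (sum_simplex_vertexE (fun=> 1)) subrr mxE.
    by rewrite scale1r.
  by rewrite /c -scaler_sumr -linear_sum -mulmx_sumr v0 mulmx0 linear0 scaler0.
have part_sum (g : 'I_((d + 1) * s).+1 -> R) (j : 'I_s.+1) :
    \sum_x (l x * g x) *: simplex_vertex R (f x) = 0 ->
    \sum_(x | f x == j) l x * g x = \sum_(x | f x == ord_max) l x * g x.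
  move=> g0; pose y j' := \sum_(x | f x == j') l x * g x.
  suff /(@sum_simplex_vertex_inj _ _ y (fun=> 0) j) : \sum_j y j *: simplex_vertex R j =
      \sum_(j < s.+1) 0 *: simplex_vertex R j by rewrite !subr0.
  rewrite [RHS]big1 => [|i _]; last by rewrite scale0r.
  rewrite -[RHS]g0 [RHS](partition_big f xpredT)//=; apply: eq_bigr => j' _.
  by rewrite scaler_suml; apply: eq_bigr => x /eqP ->.
have b_eq0 e : \sum_x (l x * b x 0 e) *: simplex_vertex R (f x) = 0.
  apply/rowP => i; have /(congr1 vec_mx) := l_eq0; rewrite linear_sum linear0.
  move=> /matrixP/(_ e i); rewrite !summxE !mxE => h.
  rewrite -[RHS]h; apply: eq_bigr => x _.
  by rewrite linearZ/= mxvecK !mxE big_ord1 !mxE mulrA.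
(* The last coordinate of [b x] is 1, so it compares the total weights of the parts. *)
have weightE j : \sum_(x | f x == j) l x = \sum_(x | f x == ord_max) l x.
  have := part_sum (fun x => b x 0 (rshift d ord0)) j (b_eq0 _).
  by under eq_bigr do rewrite row_mxEr mxE mulr1;
     under [X in _ = X -> _]eq_bigr do rewrite row_mxEr mxE mulr1.
set w := \sum_(x | f x == ord_max) l x in weightE.
have w0 : w != 0.
  apply/eqP => w0; move: l1; rewrite (partition_big f xpredT)//= big1 => [/eqP|j _].
    by rewrite eq_sym oner_eq0.
  by rewrite weightE.
have w_ge0 : 0 <= w by exact: sumr_ge0.
exists (fun j => [set x | f x == j]); split.
  split=> [j j' jj'|x]; last by exists (f x); rewrite finset.inE.
  apply/pred0P => x /=; rewrite !finset.inE; apply/negP => /andP[/eqP fj /eqP fj'].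
  by move: jj'; rewrite -fj -fj' eqxx.
(* One point, the weighted mean of any part, lies in all the hulls at once, so it serves every
   [J]. *)
move=> J _; exists (w^-1 *: \sum_(x | f x == ord_max) l x *: a x) => j _.
apply/convex_hull_finP; exists (fun x => if f x == j then w^-1 * l x else 0).
  split=> [x|x|]; last by rewrite -big_mkcond -mulr_sumr weightE mulVf.
    by case: ifP => // _; rewrite mulr_ge0// invr_ge0.
  by rewrite finset.inE => /negPf ->.
apply/rowP => e.
have pe : \sum_(x | f x == j) l x * a x 0 e = \sum_(x | f x == ord_max) l x * a x 0 e.
  have := part_sum (fun x => b x 0 (lshift 1 e)) j (b_eq0 _).
  by under eq_bigr do rewrite row_mxEl;
     under [X in _ = X -> _]eq_bigr do rewrite row_mxEl.
rewrite !mxE !summxE.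
under eq_bigr do rewrite mxE.
under [RHS]eq_bigr do rewrite mxE (fun_if (fun t => t * _)) mul0r -mulrA.
rewrite -big_mkcond -mulr_sumr; congr (_ * _).
by rewrite pe.
Qed.

(** * Averaging over k-subsets *)

(** Among the (k+1)-subsets of a set of a+1+b elements are those inside the first a+1 and those made
    of one of the other b and k from a fixed a of the first. *)
Lemma leq_bin_split (a b k : nat) :
  ('C(a.+1, k.+1) + b * 'C(a, k) <= 'C(a.+1 + b, k.+1))%N.
Proof.
elim: b => [|b IHb]; first by rewrite mul0n !addn0.
rewrite mulSn addnCA [in leqRHS]addnS [in leqRHS]binS addnC; apply: leq_add => //.
by apply: leq_bin2l; rewrite addSn -addnS leq_addr.
Qed.

(** Deleting [e] is injective on these sets and yields k-subsets of [A :\ e]. *)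
Lemma card_draws_mem (T : finType) (A : {set T}) (e : T) (k : nat) :
  (#|[set K : {set T} | K \subset A & (#|K| == k.+1) && (e \in K)]| <= 'C(#|A|.-1, k))%N.
Proof.
have [eA|eA] := boolP (e \in A); last first.
  rewrite eq_card0// => K; rewrite !inE; apply/negP => /and3P[/subsetP KA _ eK].
  by rewrite KA in eA.
have -> : #|A|.-1 = #|A :\ e| by rewrite (cardsD1 e A) eA.
rewrite -cards_draws -(@card_in_imset _ _ (fun K => K :\ e)) => [|K1 K2]; last first.
  rewrite !inE => /and3P[_ _ e1] /and3P[_ _ e2] h.
  by rewrite -(setD1K e1) h setD1K.
apply/subset_leq_card/subsetP => _ /imsetP[K + ->].
rewrite !inE => /and3P[KA /eqP cK eK]; rewrite setSD//=.
by move: cK; rewrite (cardsD1 e) eK add1n => -[->].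
Qed.

(** Only the K inside [A = J :\: M] contribute. Counting pairs (K, e) with e in E bounds the sum by
    ['C(#|A|, k.+1) + #|E| * 'C(#|A|.-1, k)], and [#|A| + #|E| < #|J|]. *)
Lemma sum_draws_avoiding (T : finType) (J M E : {set T}) (k : nat) :
  M \subset J -> (#|E| < #|M|)%N ->
  (\sum_(K : {set T} | (K \subset J) && (#|K| == k.+1))
     (if [disjoint K & M] then 1 + #|K :&: E| else 0) <= 'C(#|J|.-1, k.+1))%N.
Proof.
move=> MJ EM.
rewrite -big_mkcondr /=.
rewrite (eq_bigl (fun K : {set T} => (K \subset J :\: M) && (#|K| == k.+1))); last first.
  by move=> K; rewrite subsetD -andbA [X in _ && X]andbC andbA.
set A := J :\: M.
have cA : (#|J| = #|A| + #|M|)%N by rewrite -(cardsID M J) (setIidPr MJ) addnC.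
rewrite big_split /= sum1_card.
have -> : #|[pred i : {set T} | i \subset A & #|i| == k.+1]| = 'C(#|A|, k.+1).
  by rewrite -cards_draws cardsE.
have -> : (\sum_(i : {set T} | (i \subset A) && (#|i| == k.+1)) #|i :&: E| =
   \sum_(e in E) #|[set K : {set T} | K \subset A & (#|K| == k.+1) && (e \in K)]|)%N.
  rewrite (eq_bigr (fun K : {set T} => \sum_(e in K :&: E) 1)%N) => [|K _]; last by rewrite sum1_card.
  rewrite (exchange_big_dep (mem E)) /=; last by move=> K e _; rewrite inE => /andP[].
  apply: eq_bigr => e eE; rewrite -sum1_card; apply: eq_bigl => K.
  by rewrite !inE eE andbT andbA.
have [A0|A0] := posnP #|A|.
  rewrite A0 bin0n/= big1// => e _; apply: eq_card0 => K; rewrite !inE.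
  apply/negP => /and3P[KA /eqP cK _].
  by move: (subset_leq_card KA); rewrite A0 cK.
apply: (@leq_trans ('C(#|A|, k.+1) + #|E| * 'C(#|A|.-1, k))%N).
  rewrite leq_add2l -sum_nat_const; apply: leq_sum => e _; exact: card_draws_mem.
rewrite cA -{1 2}(prednK A0) (leq_trans (leq_bin_split _ _ _))// leq_bin2l//.
by rewrite prednK// -ltnS prednK ?addn_gt0 ?A0// -addnS leq_add2l.
Qed.

Lemma sum_card_disjoint_le (X I : finType) (F : I -> {set X}) (A : {set X}) :
  (forall j k, j != k -> [disjoint F j & F k]) -> (forall j, F j \subset A) ->
  (\sum_j #|F j| <= #|A|)%N.
Proof.
move=> disjF FA; rewrite -[leqRHS]sum1_card.
rewrite (eq_bigr (fun j => \sum_(x in A) (x \in F j : nat))%N); last first.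
  move=> j _; rewrite -big_mkcondr/= -sum1_card; apply: eq_bigl => x.
  by rewrite andbC; case: (boolP (x \in F j)) => //= /(subsetP (FA j)).
rewrite exchange_big/=; apply: leq_sum => x _.
rewrite -big_mkcond/= sum1_card; apply/card_le1_eqP => j k jx kx.
apply/eqP; apply: contraT => /disjF/pred0P/(_ x)/=.
by move: jx kx; rewrite !unfold_in /= => -> ->.
Qed.

(** For each j, 1 + [1 < |F j|] <= |F j| + [F j empty]; sum over j and use that the sizes add up to
    less than |I|. *)
Lemma card_large_lt_empty (X I : finType) (F : I -> {set X}) (A : {set X}) :
  (forall j k, j != k -> [disjoint F j & F k]) -> (forall j, F j \subset A) ->
  (#|A| < #|I|)%N ->
  (#|[set j | 1 < #|F j|]| < #|[set j | F j == finset.set0]|)%N.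
Proof.
move=> disjF FA AI; rewrite -(ltn_add2l #|A|).
apply: (@leq_trans (#|I| + #|[set j | (1 < #|F j|)%N]|)%N).
  by rewrite -addSn leq_add2r.
rewrite (@leq_trans (\sum_j #|F j| + #|[set j | F j == finset.set0]|)%N)//.
  rewrite -(sum1_card I) -!sum1_card !(big_mkcond (mem [set j | _]))/=.
  rewrite -!big_split/=; apply: leq_sum => j _; rewrite !inE -cards_eq0.
  by case: #|F j| => [|[]].
by rewrite leq_add2r sum_card_disjoint_le.
Qed.

Lemma exists_draw_few_hits (I T : finType) (J : {set T}) (M E : I -> {set T}) (k : nat) :
  (k.+1 < #|J|)%N -> (forall i, M i \subset J) -> (forall i, #|E i| < #|M i|)%N ->
  (#|I| * (#|T| - k.+1) < k.+1 * #|T|)%N ->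
  exists K : {set T}, [/\ K \subset J, #|K| = k.+1 &
    (\sum_i (if [disjoint K & M i] then 1 + #|K :&: E i| else 0) < #|K|)%N].
Proof.
move=> kJ MJ EM hIT.
have [[K [KJ cK lt]]|none] := pselect (exists K : {set T}, [/\ K \subset J, #|K| = k.+1 &
    (\sum_i (if [disjoint K & M i] then 1 + #|K :&: E i| else 0) < #|K|)%N]).
  by exists K.
exfalso.
have : (\sum_(K : {set T} | (K \subset J) && (#|K| == k.+1)) k.+1 <=
    \sum_(i : I) 'C(#|J|.-1, k.+1))%N.
  apply: (@leq_trans (\sum_(K : {set T} | (K \subset J) && (#|K| == k.+1))
     \sum_i (if [disjoint K & M i] then 1 + #|K :&: E i| else 0))%N).
    apply: leq_sum => K /andP[KJ /eqP cK]; rewrite leqNgt; apply/negP => lt.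
    by apply: none; exists K; rewrite cK.
  rewrite exchange_big/=; apply: leq_sum => i _.
  exact: sum_draws_avoiding.
rewrite !sum_nat_const cardT -cardE/=.
have -> : #|[pred K : {set T} | K \subset J & #|K| == k.+1]| = 'C(#|J|, k.+1).
  by rewrite -cards_draws cardsE.
(* This identity turns the summed bound into (k+1) q <= |I| (q - k - 1) with q = |J|; as (q - k - 1)
   / q grows with q, it would also hold for q = |T|. *)
have e := mul_bin_down #|J| k.+1.
have b0 : (0 < 'C(#|J|, k.+1))%N by rewrite bin_gt0 ltnW.
move=> h.
have {h e} : (k.+1 * #|J| * 'C(#|J|, k.+1) <= #|I| * (#|J| - k.+1) * 'C(#|J|, k.+1))%N.
  by rewrite -[leqRHS]mulnA -e mulnCA mulnAC mulnC leq_mul// mulnC.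
rewrite leq_pmul2r//.
have JT : (#|J| <= #|T|)%N by exact: max_card.
move=> h; nia.
Qed.

Lemma exists_superset_card (T : finType) (A : {set T}) (k : nat) :
  (#|A| <= k <= #|T|)%N -> exists2 B : {set T}, A \subset B & #|B| = k.
Proof.
case/andP; elim: k => [|k IHk] Ak kT.
  by exists A => //; apply/eqP; rewrite -leqn0.
have [Ak1|Ak1] := eqVneq #|A| k.+1; first by exists A.
have [|B AB cB] := IHk _ (ltnW kT); first by rewrite -ltnS ltn_neqAle Ak1.
have /set0Pn[x] : ~: B != finset.set0.
  by rewrite -card_gt0 -subn_gt0 -[#|~: B|]addn0 in kT *; have := cardsC B; lia.
rewrite inE => xB; exists (x |: B); last by rewrite cardsU1 xB cB.
by rewrite (subset_trans AB) ?subsetU1.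
Qed.

(** * Points on rays *)

Section RayPoints.
Variables (R : realType) (d : nat) (X : finType).
Variables (ray : X -> 'I_d.+1) (level : X -> nat).
Hypothesis inj_ray_level : forall x y, ray x = ray y -> level x = level y -> x = y.

(** The base d + 2 exceeds the number d + 1 of rays, so that d + 1 masses of at most 1 / (d + 2)
    cannot add up to 1. *)
Definition ray_point (x : X) : 'rV[R]_d :=
  d.+2%:R ^+ level x *: simplex_vertex R (ray x).

Definition ray_coord (l : X -> R) (i : 'I_d.+1) : R :=
  \sum_(x | ray x == i) l x * d.+2%:R ^+ level x.

Lemma sum_ray_point (l : X -> R) :
  \sum_x l x *: ray_point x = \sum_i ray_coord l i *: simplex_vertex R i.
Proof.
rewrite (partition_big ray xpredT)//=; apply: eq_bigr => i _.
rewrite scaler_suml; apply: eq_bigr => x /eqP <-.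
by rewrite scalerA.
Qed.

Definition misses_ray (A : {set X}) (i : 'I_d.+1) : bool :=
  [forall x in A, ray x != i].

Definition on_ray (A : {set X}) (i : 'I_d.+1) : {set X} :=
  [set x in A | ray x == i].

Lemma misses_rayE (A : {set X}) (i : 'I_d.+1) :
  misses_ray A i = (on_ray A i == finset.set0).
Proof.
apply/forall_inP/eqP => [h|h x xA].
  by apply/setP => x; rewrite !inE; apply/negP => /andP[/h/negPf ->].
by apply/negP => rx; have := in_set0 x; rewrite -h inE xA rx.
Qed.

Lemma ray_coord_ge0 (A : {set X}) (l : X -> R) (i : 'I_d.+1) :
  convex_weights A l -> 0 <= ray_coord l i.
Proof. by case=> l0 _ _; apply: sumr_ge0 => x _; rewrite mulr_ge0// exprn_ge0. Qed.

Lemma ray_coordE (A : {set X}) (l : X -> R) (i : 'I_d.+1) :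
  convex_weights A l ->
  ray_coord l i = \sum_(x in on_ray A i) l x * d.+2%:R ^+ level x.
Proof.
case=> _ lA _; rewrite /ray_coord (bigID (mem A))/= addrC big1 ?add0r.
  by apply: eq_bigl => x; rewrite !inE andbC.
by move=> x /andP[_ /lA ->]; rewrite mul0r.
Qed.

Lemma ray_coord_missed (A : {set X}) (l : X -> R) (i : 'I_d.+1) :
  convex_weights A l -> misses_ray A i -> ray_coord l i = 0.
Proof.
by move=> Al; rewrite misses_rayE (ray_coordE _ Al) => /eqP ->; rewrite big_set0.
Qed.

(* Along the relation [sum of the vertices = 0] the coordinates of a point are
   defined up to a common constant; missing a ray normalises their minimum to 0. *)
Lemma ray_coord_unique (A B : {set X}) (l m : X -> R) (i : 'I_d.+1) :
  convex_weights A l -> convex_weights B m ->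
  (exists i, misses_ray A i) -> (exists i, misses_ray B i) ->
  \sum_x l x *: ray_point x = \sum_x m x *: ray_point x ->
  ray_coord l i = ray_coord m i.
Proof.
move=> Al Bm [iA Ai] [iB Bi]; rewrite !sum_ray_point => h.
have hA := sum_simplex_vertex_inj iA h; have hB := sum_simplex_vertex_inj iB h.
have hi := sum_simplex_vertex_inj i h.
have lB := ray_coord_ge0 iB Al; have mA := ray_coord_ge0 iA Bm.
have := ray_coord_missed Al Ai; have := ray_coord_missed Bm Bi.
lra.
Qed.

Lemma sum_convex_weights_rays (A : {set X}) (l : X -> R) :
  convex_weights A l -> \sum_i \sum_(x in on_ray A i) l x = 1.
Proof.
case=> _ lA <-; rewrite (partition_big ray xpredT)//=; apply: eq_bigr => i _.
rewrite [RHS](bigID (mem A))/= [X in _ = _ + X]big1 ?addr0.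
  by apply: eq_bigl => x; rewrite !inE andbC.
by move=> x /andP[_ /lA].
Qed.

Lemma card_parts_le (I : finType) (N : I -> {set X}) (K : {set I}) (p : 'rV[R]_d) :
  (forall j k, j != k -> [disjoint N j & N k]) ->
  (forall j, j \in K -> exists i, misses_ray (N j) i) ->
  (forall j, j \in K -> convex_hull [set ray_point x | x in [set` N j]]%classic p) ->
  (#|K| <= \sum_(i < d.+1) if [disjoint K & [set j | misses_ray (N j) i]]
     then 1 + #|K :&: [set j | 1 < #|on_ray (N j) i|]| else 0)%N.
Proof.
move=> disjN missK hullK.
have [->|[j1 j1K]] := set_0Vmem K; first by rewrite cards0.
have /choice[l lP] : forall j, exists l : X -> R, j \in K ->
    convex_weights (N j) l /\ p = \sum_x l x *: ray_point x.
  move=> j; have [jK|] := boolP (j \in K); last by exists (fun=> 0).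
  by have /convex_hull_finP[l lN pE] := hullK _ jK; exists l.
pose y := ray_coord (l j1).
have yE j i : j \in K -> ray_coord (l j) i = y i.
  move=> jK; have [w e] := lP _ jK; have [w1 e1] := lP _ j1K.
  by apply: (ray_coord_unique i w w1); [exact: missK|exact: missK|rewrite -e -e1].
(* The part [j0 i] has the lowest top level on ray i, so [d.+2%:R ^+ top i (j0 i)] is the T_i of the
   overview; [bad i] collects the parts with a point at that distance or closer. *)
pose top i j := (\max_(x in on_ray (N j) i) level x)%N.
pose j0 i := [arg min_(j < j1 in K) top i j].
have j0K i : j0 i \in K by rewrite /j0; case: arg_minnP.
have j0min i j : j \in K -> (top i (j0 i) <= top i j)%N.
  by rewrite /j0; case: arg_minnP => // k _ + jK; exact.
pose bad i := [set j in K | [exists x in on_ray (N j) i, (level x <= top i (j0 i))%N]].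
have hit j i : j \in K -> y i != 0 -> on_ray (N j) i != finset.set0.
  move=> jK; apply: contraNN; rewrite -misses_rayE => /(ray_coord_missed (lP _ jK).1).
  by rewrite yE// => ->.
have topE i j : j \in K -> y i != 0 -> exists2 x, x \in on_ray (N j) i & top i j = level x.
  move=> jK yi; have : (0 < #|on_ray (N j) i|)%N by rewrite card_gt0 hit.
  by move=> /(eq_bigmax_cond level)[x xN e]; exists x.
(* A bad part with a single point on the ray has that point at level [top i (j0 i)]; [j0 i] owns the
   only point there, so by disjointness the part is [j0 i]. *)
have badE i : y i != 0 ->
    (#|bad i| <= 1 + #|K :&: [set j | (1 < #|on_ray (N j) i|)%N]|)%N.
  move=> yi; rewrite -[X in (_ <= X + _)%N](cards1 (j0 i)); apply: leq_trans (leq_card_setU _ _).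
  apply/subset_leq_card/subsetP => j; rewrite !inE => /andP[jK].
  move=> /exists_inP[x xN lex]; rewrite jK/=.
  have [//|jj0/=] := eqVneq j (j0 i).
  rewrite ltnNge; apply/negP => single.
  have [x0 x0N e0] := topE i (j0 i) (j0K i) yi.
  have [x1 x1N e1] := topE i j jK yi.
  have xx1 : x = x1.
    by apply: (card_le1_eqP single).
  have lev : level x = level x0.
    by apply/eqP; move: lex (j0min i j jK); rewrite eqn_leq e0 e1 -xx1 => -> ->.
  move: xN x0N; rewrite !inE => /andP[xNj /eqP rx] /andP[x0Nj /eqP rx0].
  have xx0 : x = x0 by apply: inj_ray_level; rewrite ?rx.
  have /pred0P/(_ x)/= := disjN _ _ jj0.
  by rewrite xNj xx0 x0Nj.
suff Ksub : K \subset \bigcup_(i | y i != 0) bad i.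
  apply: leq_trans (subset_leq_card Ksub) _.
  apply: (@leq_trans (\sum_(i | y i != 0%R) #|bad i|)%N).
    elim/big_rec2 : _ => [|i m A _ h]; first by rewrite cards0.
    by rewrite (leq_trans (leq_card_setU _ _))// leq_add2l.
  rewrite big_mkcond/=; apply: leq_sum => i _; case: ifP => // yi.
  rewrite ifT ?badE//; apply/pred0P => j /=; rewrite inE.
  apply/negP => /andP[jK]; rewrite misses_rayE; apply/negP.
  exact: hit.
apply/subsetP => j jK; apply/bigcupP.
have [[i [yi ji]]|none] := pselect (exists i, y i != 0 /\ j \in bad i).
  by exists i.
exfalso.
have [wj ej] := lP _ jK.
(* All distances are at least 1, so a ray with [y i = 0] carries no mass; on the others, having no
   bad point costs a factor d + 2. *)
have small i : \sum_(x in on_ray (N j) i) l j x <= d.+2%:R^-1.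
  have [yi|yi] := eqVneq (y i) 0.
    have : \sum_(x in on_ray (N j) i) l j x <= y i.
      rewrite -(yE j)// (ray_coordE _ wj); apply: ler_sum => x _.
      by rewrite ler_peMr ?exprn_ege1 ?ler1n//; case: wj.
    by rewrite yi => /le_trans; apply; rewrite invr_ge0.
  have [w0 e0] := lP _ (j0K i).
  have up : y i <= d.+2%:R ^+ top i (j0 i).
    rewrite -(yE (j0 i))// (ray_coordE _ w0).
    apply: (@le_trans _ _ (\sum_(x in on_ray (N (j0 i)) i)
        l (j0 i) x * d.+2%:R ^+ top i (j0 i))).
      apply: ler_sum => x xN; rewrite ler_wpM2l//; first by case: w0.
      by rewrite ler_weXn2l ?ler1n//; exact: leq_bigmax_cond.
    rewrite -mulr_suml ler_piMl ?exprn_ge0//.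
    rewrite -(sum_convex_weights_rays w0) (bigD1 i)//= lerDl.
    by apply: sumr_ge0 => i' _; apply: sumr_ge0 => x _; case: w0.
  have low : (\sum_(x in on_ray (N j) i) l j x) * d.+2%:R ^+ (top i (j0 i)).+1 <= y i.
    rewrite -(yE j)// (ray_coordE _ wj) mulr_suml; apply: ler_sum => x xN.
    rewrite ler_wpM2l//; first by case: wj.
    rewrite ler_weXn2l ?ler1n// ltnNge; apply/negP => lex; apply: none.
    by exists i; split=> //; rewrite inE jK; apply/exists_inP; exists x.
  have t0 : 0 < d.+2%:R ^+ top i (j0 i) :> R by rewrite exprn_gt0.
  rewrite -[leLHS]mulr1 -[leRHS]mul1r ler_pdivlMr// mulr1.
  by move: (le_trans low up); rewrite exprS mulrA ger_pMl.
have : 1 <= \sum_(i < d.+1) (d.+2%:R^-1 : R).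
  by rewrite -{1}(sum_convex_weights_rays wj) ler_sum.
rewrite sumr_const card_ord -[_ *+ _]mulr_natl ler_pdivlMr// mul1r ler_nat.
by rewrite ltnn.
Qed.

End RayPoints.

(** Covering every m up to the bound yields minimality directly, with no monotonicity in the number
    of points. *)
Lemma not_tverberg_property (R : realType) (d r k m : nat) :
  (0 < k)%N -> (k < r)%N -> (d.+1 * (r - k) < k * r)%N -> (m <= d.+1 * (r - 1))%N ->
  ~ tverberg_property R d r k m.
Proof.
case: k => // k _ kr dkr mle.
(* Dealing the indices out cyclically puts at most r - 1 points on each ray, at distinct levels. *)
pose ray (x : 'I_m) : 'I_d.+1 := Ordinal (ltn_pmod x (ltn0Sn d)).
pose level (x : 'I_m) := (x %/ d.+1)%N.
have inj_rl x y : ray x = ray y -> level x = level y -> x = y.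
  move=> /(congr1 val)/= rxy lxy; apply: val_inj.
  by rewrite /= (divn_eq x d.+1) rxy -/(level x) lxy -divn_eq.
move=> /(_ (ray_point R ray level))[N [[disjN _] hullN]].
pose M i := [set j | misses_ray ray (N j) i].
pose E i := [set j | (1 < #|on_ray ray (N j) i|)%N].
have EM i : (#|E i| < #|M i|)%N.
  have -> : M i = [set j | on_ray ray (N j) i == finset.set0].
    by apply/setP => j; rewrite !inE misses_rayE.
  apply: (@card_large_lt_empty _ _ (fun j => on_ray ray (N j) i) [set x | ray x == i]).
  - move=> j l /disjN; apply: disjointW.
      by apply/subsetP => x; rewrite inE => /andP[].
    by apply/subsetP => x; rewrite inE => /andP[].
  - by move=> j; apply/subsetP => x; rewrite !inE => /andP[].
  - have lt (x : 'I_m) : (level x < r - 1)%N.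
      by rewrite ltn_divLR// mulnC (leq_trans (ltn_ord x)).
    rewrite -(@card_in_imset _ _ (fun x => Ordinal (lt x))).
      rewrite (leq_ltn_trans (max_card _))// !card_ord; lia.
    move=> x y; rewrite !inE => /eqP rx /eqP ry /(congr1 val)/= lxy.
    by apply: inj_rl => //; rewrite rx.
pose J := [set j | [exists i, misses_ray ray (N j) i]].
have MJ i : M i \subset J.
  by apply/subsetP => j; rewrite !inE => ?; apply/existsP; exists i.
have few (K : {set 'I_r}) : K \subset J ->
    (exists p, forall j, j \in K ->
      convex_hull [set ray_point R ray level x | x in [set` N j]]%classic p) ->
    (#|K| <= \sum_i (if [disjoint K & M i] then 1 + #|K :&: E i| else 0))%N.
  move=> KJ [p hp]; apply: (card_parts_le inj_rl disjN _ hp) => j jK.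
  by have := subsetP KJ j jK; rewrite inE => /existsP.
have [kJ|Jk] := ltnP k.+1 #|J|.
  have [|K [KJ cK]] := exists_draw_few_hits kJ MJ EM; first by rewrite !card_ord.
  by rewrite ltnNge few//; exact: hullN.
(* The property speaks only of sets of exactly k+1 parts, so [J] is enlarged to one. Every [M i] is
   a nonempty subset of [J], so the bound for K = J is 0, although [J] is not empty. *)
have [|B JB cB] := @exists_superset_card _ J k.+1; first by rewrite Jk card_ord ltnW.
have [p hp] := hullN B cB.
have := few J (subxx _); rewrite big1 => [h|i _].
  have /cards0_eq J0 : #|J| = 0%N.
    by apply/eqP; rewrite -leqn0 h//; exists p => j /(subsetP JB)/hp.
  have := EM ord0; have := MJ ord0.
  by rewrite J0 subset0 => /eqP ->; rewrite cards0.
rewrite ifF//; apply/negP => /pred0P dis.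
have /card_gt0P[j jM] : (0 < #|M i|)%N by exact: leq_ltn_trans (EM i).
by have := dis j; rewrite /= jM (subsetP (MJ i) _ jM).
Qed.

Theorem theorem4 (R : realType) (d r k : nat)
    (hk : (2 <= k)%N) (hkr : (k < r)%N) (hd : (1 <= d)%N)
    (hdkr : (d%:R : R) < (k%:R * r%:R) / (r%:R - k%:R) - 1) :
  is_tverberg_number R d r k ((d + 1) * (r - 1) + 1)%N.
Proof.
(* The real hypothesis is cleared of its positive denominator r - k. *)
have dkr : (d.+1 * (r - k) < k * r)%N.
  have rk : 0 < r%:R - k%:R :> R by rewrite subr_gt0 ltr_nat.
  rewrite -(ltr_nat R) !natrM natrB ?(ltnW hkr)// -ltr_pdivlMr//.
  by rewrite -natr1 -ltrBrDr.
have r0 : (0 < r)%N by exact: leq_ltn_trans hkr.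
split; first by rewrite addn1.
  rewrite addn1 -{1}(subnK r0) addn1; exact: tverberg_property_upper.
move=> m _ hm; rewrite leqNgt; apply/negP => lt.
apply: (not_tverberg_property _ hkr dkr _ hm); first exact: ltnW.
by rewrite -[d.+1]addn1 -ltnS -[X in (_ < X)%N]addn1.
Qed.
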